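(* Let $K$ be a field complete with respect to a non-trivial discrete valuation $v$ and with perfect residue field, let $T$ be the torus of diagonal matrices in $SL_{n,K}$, and let $A=X_\ast(T)\otimes_{\mathbb{Z}}\mathbb{R}=\{\sum_{i=1}^n x_i\eta_i : x_i\in\mathbb{R},\ \sum_i x_i=0\}$ be the corresponding apartment in the Bruhat-Tits building $\mathfrak{B}(SL_{n,K})$. Let $x=\sum_i x_i\eta_i$ be a point in $A$. Then the stabilizer $P_x$ of $x$ with respect to the action of $SL_n(K)$ on $\mathfrak{B}(SL_{n,K})$ is equal to the set of all elements of $SL_n(K)$ which stabilize the vector ${}^t(x_1,\ldots,x_n)$ tropically, i.e. \[P_x=\Bigl\{g=(g_{ij})\in SL_n(K) : \max_{j}\{-v(g_{ij})+x_j\}=x_i \text{ for all } i=1,\ldots,n\Bigr\}.\]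
   Context: $\mathcal{O}_K=\{a\in K: v(a)\ge 0\}$, with $v(0)=\infty$, so $-v$ takes values in $\mathbb{R}\cup\{-\infty\}$; $-\infty+a=-\infty$ and $\max\{a,-\infty\}=a$. Tropical stabilization: for $g=(g_{ij})\in GL_n(K)$ and $x={}^t(x_1,\ldots,x_n)\in\mathbb{R}^n$ put $g_{\mathrm{trop}}\cdot x={}^t(y_1,\ldots,y_n)$ with $y_i=\max_j\{-v(g_{ij})+x_j\}$. An element $g\in SL_n(K)$ stabilizes $x$ tropically if $g_{\mathrm{trop}}\cdot x=x$. Building of $SL_{n,K}$: $\eta_i:\mathbb{G}_m\to GL_{n,K}$ is the cocharacter sending $s$ to the diagonal matrix with $i$-th entry $s$ and all other diagonal entries $1$. Let $N$ be the normalizer of $T$ in $SL_{n,K}$. An element $t=\mathrm{diag}(t_1,\ldots,t_n)\in T(K)$ acts on $A$ by translation by $\nu(t)=\sum_i -v(t_i)\eta_i$; this extends to an action of $N(K)$ by affine-linear maps, where $m\in N(K)$ with $m(e_i)=t_ie_{\sigma(i)}$ (for a permutation $\sigma$ and $t_i\in K^\ast$) sends $\sum_i x_i\eta_i$ to $\sum_i (x_i-v(t_i))\eta_{\sigma(i)}$. For $x=\sum_i x_i\eta_i\in A$, the Bruhat-Tits group $P_x\subset SL_n(K)$ is the subgroup generated by the stabilizer of $x$ in $N(K)$ and all elementary matrices $1+uE_{ij}$ with $i\ne j$, $u\in K$, $-v(u)\le x_i-x_j$; for example $P_0=SL_n(\mathcal{O}_K)$. The building $\mathfrak{B}(SL_{n,K})$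 is the quotient of $SL_n(K)\times A$ by the equivalence relation $(g,x)\sim(h,y)$ iff there is $m\in N(K)$ with $mx=y$ and $g^{-1}hm\in P_x$; $SL_n(K)$ acts by left multiplication on the first factor, $A$ is embedded by $x\mapsto(1,x)$, and $P_x$ is the stabilizer of $x\in A$ in $SL_n(K)$. *)

(* Defs.v *)
From HB Require Import structures.
From mathcomp Require Import all_boot all_order all_fingroup all_algebra.
From mathcomp Require Import generic_quotient.
From mathcomp Require Import boolp classical_sets reals constructive_ereal.
From mathcomp Require Import lra.

Set Implicit Arguments.
Unset Strict Implicit.
Unset Printing Implicit Defensive.

Import Order.TTheory GRing.Theory Num.Theory.
Local Open Scope classical_set_scope.
Local Open Scope ring_scope.
Local Open Scope quotient_scope.

Record valuation (R : realType) (K : fieldType) := Valuation {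
  valuation_val :> K -> \bar R ;
  valuation_gtNy : forall a, (-oo < valuation_val a)%E ;
  valuation_eqy : forall a, valuation_val a = +oo%E <-> a = 0 ;
  valuationM : forall a b,
    valuation_val (a * b) = (valuation_val a + valuation_val b)%E ;
  valuationD : forall a b,
    (mine (valuation_val a) (valuation_val b) <= valuation_val (a + b)%R)%E }.

Section ValuedFields.
Variables (R : realType) (K : fieldType) (v : valuation R K).

Definition nontrivial_val := exists2 a : K, a != 0 & v a <> 0%E.

Definition discrete_val := exists2 c : R,
  0 < c & forall a, a != 0 -> exists k : int, v a = (k%:~R * c)%:E.

Definition val_cauchy (u : nat -> K) := forall M : R,
  exists N : nat, forall p q, (N <= p)%N -> (N <= q)%N ->
    (M%:E <= v (u p - u q)%R)%E.

Definition val_cvg (u : nat -> K) (l : K) := forall M : R,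
  exists N : nat, forall p, (N <= p)%N -> (M%:E <= v (u p - l)%R)%E.

Definition complete_val := forall u, val_cauchy u -> exists l, val_cvg u l.

Lemma valuation0 : v 0 = +oo%E. Proof. exact/valuation_eqy. Qed.

Lemma valuation_fin a : a != 0 -> v a \is a fin_num.
Proof.
move=> a0; rewrite fin_numE; apply/andP; split.
  by have := valuation_gtNy v a; rewrite lt_neqAle eq_sym => /andP[].
by apply/eqP => /valuation_eqy a0'; rewrite a0' eqxx in a0.
Qed.

Lemma valuation1 : v 1 = 0%E.
Proof.
have /fineK v1 := valuation_fin (oner_neq0 K).
have := valuationM v 1 1; rewrite mulr1 -v1 -EFinD => -[] /eqP.
by rewrite -subr_eq subrr eq_sym => /eqP ->.
Qed.

Lemma fine_valuationM a b : a != 0 -> b != 0 ->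
  fine (v (a * b)) = fine (v a) + fine (v b).
Proof. by move=> a0 b0; rewrite valuationM fineD ?valuation_fin. Qed.

Lemma fine_valuationV a : a != 0 -> fine (v a^-1) = - fine (v a).
Proof.
move=> a0; apply/eqP; rewrite -addr_eq0 -fine_valuationM ?invr_eq0// mulVf//.
by rewrite valuation1.
Qed.

Lemma valuationN a : v (- a) = v a.
Proof.
suff vN1 : v (-1) = 0%E by rewrite -mulN1r valuationM vN1 add0e.
have N1 : -1 != 0 :> K by rewrite oppr_eq0 oner_neq0.
have := fine_valuationM N1 N1; rewrite mulrNN mulr1 valuation1 /= => /esym/eqP.
rewrite -mulr2n mulrn_eq0 /= => /eqP v0.
by rewrite -(fineK (valuation_fin N1)) v0.
Qed.

Definition valring : {pred K} := [pred a | (0 <= v a)%E].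

Lemma valring_subring : subring_closed valring.
Proof.
split=> [|a b|a b]; rewrite !inE ?valuation1// => a0 b0.
- by apply: le_trans (valuationD v a (- b)); rewrite le_min a0 valuationN.
- by rewrite valuationM adde_ge0.
Qed.

HB.instance Definition _ := GRing.isSubringClosed.Build K valring
  valring_subring.

Record integers := Integer { integer_val :> K; _ : integer_val \in valring }.

HB.instance Definition _ := [isSub for integer_val].
HB.instance Definition _ := [Choice of integers by <:].
HB.instance Definition _ := [SubChoice_isSubComNzRing of integers by <:].

Definition maximal_ideal : {pred integers} := [pred a | (0 < v (val a))%E].

Lemma maximal_ideal_closed : idealr_closed maximal_ideal.
Proof.
split=> [||a b c]; rewrite !inE.
- by rewrite rmorph0 valuation0 ltry.
- by rewrite rmorph1 valuation1 ltxx.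
move=> b0 c0; rewrite rmorphD rmorphM.
apply: lt_le_trans (valuationD v _ _); rewrite lt_min c0 andbT valuationM.
by have := valP a; rewrite inE => a0; apply: (lt_le_trans b0); rewrite leeDr.
Qed.

HB.instance Definition _ := isIdealr.Build integers maximal_ideal
  maximal_ideal_closed.

Definition residue_field := {ideal_quot maximal_ideal}.
HB.instance Definition _ := GRing.ComNzRing.on residue_field.

(** Characteristic 0, or every element is a [p]-th power in characteristic
    [p > 0]. *)
Definition perfect_residue_field := forall p : nat,
  p \in [pchar residue_field] ->
  forall a : residue_field, exists b : residue_field, b ^+ p = a.

End ValuedFields.

Section SpecialLinear.
Variables (K : fieldType) (n : nat).

Record SL := MkSL { SL_mx :> 'M[K]_n ; _ : \det SL_mx == 1 }.

HB.instance Definition _ := [isSub for SL_mx].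
HB.instance Definition _ := [Choice of SL by <:].

Implicit Types g h m : SL.

Lemma det_SL g : \det g = 1. Proof. exact/eqP/(valP g). Qed.

Lemma SL_unitmx g : (g : 'M_n) \in unitmx.
Proof. by rewrite unitmxE det_SL unitr1. Qed.

Fact SL_one_subproof : \det (1%:M : 'M[K]_n) == 1.
Proof. by rewrite det1. Qed.
Fact SL_mul_subproof g h : \det (g *m h) == 1.
Proof. by rewrite det_mulmx !det_SL mulr1. Qed.
Fact SL_inv_subproof g : \det (invmx g) == 1.
Proof. by rewrite det_inv det_SL invr1. Qed.

Definition SL_one := MkSL SL_one_subproof.
Definition SL_mul g h := MkSL (SL_mul_subproof g h).
Definition SL_inv g := MkSL (SL_inv_subproof g).

Fact SL_mulA : associative SL_mul.
Proof. by move=> g h k; apply: val_inj; rewrite /= mulmxA. Qed.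
Fact SL_mul1 : left_id SL_one SL_mul.
Proof. by move=> g; apply: val_inj; rewrite /= mul1mx. Qed.
Fact SL_mulr1 : right_id SL_one SL_mul.
Proof. by move=> g; apply: val_inj; rewrite /= mulmx1. Qed.
Fact SL_mulV : left_inverse SL_one SL_inv SL_mul.
Proof. by move=> g; apply: val_inj; rewrite /= mulVmx ?SL_unitmx. Qed.
Fact SL_mulrV : right_inverse SL_one SL_inv SL_mul.
Proof. by move=> g; apply: val_inj; rewrite /= mulmxV ?SL_unitmx. Qed.

HB.instance Definition _ := isGroup.Build SL
  SL_mulA SL_mul1 SL_mulr1 SL_mulV SL_mulrV.

Lemma SL_mulE g h : ((g * h)%g : 'M_n) = g *m h. Proof. by []. Qed.
Lemma SL_invE g : ((g^-1)%g : 'M_n) = invmx g. Proof. by []. Qed.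
Lemma SL_oneE : ((1%g : SL) : 'M_n) = 1%:M. Proof. by []. Qed.

Definition subgroup (H : set SL) :=
  [/\ H 1%g, forall g h, H g -> H h -> H (g * h)%g & forall g, H g -> H g^-1%g].

Definition subgroup_generated (S : set SL) : set SL := smallest subgroup S.

Lemma subgroup_generatedP S : subgroup (subgroup_generated S).
Proof.
split=> [H [[]]//|g h Sg Sh H [HS SH]|g Sg H [HS SH]].
  by case: (HS) => _ HM _; apply: HM; [exact: Sg | exact: Sh].
by case: (HS) => _ _ HV; apply: HV; exact: Sg.
Qed.

Definition torus : set SL := [set t | is_diag_mx t].

(** Since [K] is infinite in the presence of a non-trivial valuation, the
    normalizer of the group [T(K)] is the group of [K]-points of the
    scheme-theoretic normalizer of [T]. *)
Definition normalizer_torus : set SL := [set m | (conjg^~ m) @` torus = torus].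

Definition monomial m (s : 'S_n) (t : 'I_n -> K) := forall i,
  t i != 0 /\ m *m delta_mx i 0 = t i *: (delta_mx (s i) 0 : 'cV[K]_n).

Lemma normalizer_torus_subgroup : subgroup normalizer_torus.
Proof.
split=> [|g h|g]; rewrite /normalizer_torus /=.
- by rewrite (_ : conjg^~ 1%g = id) ?image_id//; apply/funext => t; rewrite conjg1.
- move=> Ng Nh; rewrite (_ : conjg^~ (g * h)%g = conjg^~ h \o conjg^~ g).
    by rewrite -image_comp Ng.
  by apply/funext => t; rewrite /= conjgM.
- move=> Ng; rewrite -{1}Ng image_comp.
  rewrite (_ : _ \o _ = id) ?image_id//.
  by apply/funext => t; rewrite /= conjgK.
Qed.

Lemma monomialE m s t : monomial m s t ->
  forall i j, m i j = if i == s j then t j else 0.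
Proof.
move=> mst i j; have [_ /matrixP /(_ i 0)] := mst j.
by rewrite -colE !mxE eqxx andbT => ->; case: eqP; rewrite ?mulr1 ?mulr0.
Qed.

Lemma monomial1 : monomial 1%g 1%g (fun=> 1).
Proof. by move=> i; rewrite SL_oneE mul1mx scale1r perm1 oner_neq0. Qed.

Lemma monomialM m m' s s' t t' : monomial m s t -> monomial m' s' t' ->
  monomial (m' * m)%g (s * s')%g (fun i => t' (s i) * t i).
Proof.
move=> mst mst' i; have [ti0 mi] := mst i; have [t'i0 m'i] := mst' (s i).
split; first exact: mulf_neq0.
by rewrite SL_mulE -mulmxA mi -scalemxAr m'i permM scalerA mulrC.
Qed.

Lemma monomialV m s t : monomial m s t ->
  monomial m^-1%g s^-1%g (fun i => (t ((s^-1)%g i))^-1).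
Proof.
move=> mst i; have [ti0 mi] := mst ((s^-1)%g i); split; first by rewrite invr_eq0.
rewrite permKV in mi; rewrite SL_invE -[delta_mx ((s^-1)%g i) 0](mulKmx (SL_unitmx m)).
by rewrite mi -scalemxAr scalerA mulVf// scale1r.
Qed.

Lemma monomial_uniq m s s' t t' : monomial m s t -> monomial m s' t' ->
  s = s' /\ t =1 t'.
Proof.
move=> mst mst'; have ss' i : s i = s' i.
  have := monomialE mst (s i) i; rewrite eqxx (monomialE mst').
  by case: eqP => // _ ti0; have [] := mst i; rewrite -ti0 eqxx.
split=> [|i]; first exact/permP.
by have := monomialE mst (s i) i; rewrite (monomialE mst') ss' eqxx.
Qed.

Definition elementary (i j : 'I_n) (u : K) : 'M[K]_n := 1%:M + u *: delta_mx i j.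

Lemma monomial_conj_elementary m s t i j u : monomial m s t ->
  m *m elementary i j u *m invmx m = elementary (s i) (s j) (t i * u / t j).
Proof.
move=> mst; apply: (canLR (mulmxK (SL_unitmx m))).
rewrite /elementary mulmxDr mulmxDl mulmx1 mul1mx; congr (_ + _).
apply/matrixP => k l; rewrite -scalemxAr -scalemxAl !mxE.
rewrite (bigD1 i)//= big1 => [|i' i'i]; last by rewrite !mxE (negPf i'i) mulr0.
rewrite (bigD1 (s j))//= big1 => [|j' j'j]; last by rewrite !mxE (negPf j'j) andbF mul0r.
rewrite !addr0 !(monomialE mst) !mxE !eqxx /= andbT (inj_eq perm_inj) (eq_sym l j).
have [tj0 _] := mst j.
case: (k == s i); case: (eqVneq j l) => [<-|_]; rewrite ?(mulr1, mulr0, mul1r, mul0r)//.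
by rewrite mulfVK// mulrC.
Qed.

End SpecialLinear.

(** The point [\sum_i x_i eta_i] is given by its column of coordinates. *)
Record apartment (R : realType) (n : nat) :=
  Apartment { coords :> 'cV[R]_n ; _ : \sum_i coords i 0 == 0 }.

HB.instance Definition _ R n := [isSub for @coords R n].
HB.instance Definition _ R n := [Choice of apartment R n by <:].

Section Building.
Variables (R : realType) (K : fieldType) (v : valuation R K) (n : nat).
Implicit Types (x y z : apartment R n) (g h m : SL K n).

(** [N_maps m x y] is the graph of the action of [N(K)] on the apartment:
    [y = m x], where [m] sends [\sum_i x_i eta_i] to
    [\sum_i (x_i - v (t_i)) eta_(s i)]. *)
Definition N_maps m x y := normalizer_torus m /\
  exists s t, monomial m s t /\ forall i, y (s i) 0 = x i 0 - fine (v (t i)).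

Definition bt_group x : set (SL K n) := subgroup_generated
  ([set m | N_maps m x x] `|`
   [set g | exists i j u, [/\ i != j, (- v u <= (x i 0 - x j 0)%:E)%E
                            & (g : 'M_n) = elementary i j u]]).

Lemma N_maps_fun m x y z : N_maps m x y -> N_maps m x z -> y = z.
Proof.
move=> [_ [s [t [mst yE]]]] [_ [s' [t' [mst' zE]]]].
have [ss' tt'] := monomial_uniq mst mst'; rewrite -ss' in zE.
apply/val_inj/matrixP => i k; rewrite ord1 -[i](permKV s).
by rewrite yE zE tt'.
Qed.

Lemma N_maps1 x : N_maps 1%g x x.
Proof.
split; first by have [] := @normalizer_torus_subgroup K n.
exists 1%g, (fun=> 1); split; first exact: monomial1.
by move=> i; rewrite perm1 valuation1 subr0.
Qed.

Lemma N_mapsM m m' x y z : N_maps m x y -> N_maps m' y z -> N_maps (m' * m)%g x z.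
Proof.
move=> [Nm [s [t [mst yE]]]] [Nm' [s' [t' [mst' zE]]]].
split; first by have [_ NM _] := @normalizer_torus_subgroup K n; exact: NM.
exists (s * s')%g, (fun i => t' (s i) * t i); split; first exact: monomialM.
move=> i; have [ti0 _] := mst i; have [t'i0 _] := mst' (s i).
by rewrite permM zE yE fine_valuationM// opprD addrA addrAC.
Qed.

Lemma N_mapsV m x y : N_maps m x y -> N_maps m^-1%g y x.
Proof.
move=> [Nm [s [t [mst yE]]]].
split; first by have [_ _ NV] := @normalizer_torus_subgroup K n; exact: NV.
exists (s^-1)%g, (fun i => (t ((s^-1)%g i))^-1); split; first exact: monomialV.
move=> i; have [ti0 _] := mst ((s^-1)%g i).
by rewrite fine_valuationV// opprK -[in y i 0](permKV s i) yE subrK.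
Qed.

Lemma bt_group_conj m x y g : N_maps m x y -> bt_group x g ->
  bt_group y (m * g * m^-1)%g.
Proof.
move=> mxy; set H := [set g | bt_group y (m * g * m^-1)%g].
suff HP : bt_group x `<=` H by exact: HP.
have [P1 PM PV] : subgroup (bt_group y) by exact: subgroup_generatedP.
apply: smallest_sub; last first.
  move=> h [mh|[i [j [u [ij uij hE]]]]]; apply: sub_gen_smallest.
    by left; apply: N_mapsM (N_mapsV mxy) (N_mapsM mh mxy).
  have [_ [s [t [mst yE]]]] := mxy; right.
  exists (s i), (s j), (t i * u / t j); split.
  - by rewrite (inj_eq perm_inj).
  - have [[ti0 _] [tj0 _]] := (mst i, mst j).
    rewrite !yE; have [u0|u0] := eqVneq u 0.
      by rewrite u0 mulr0 mul0r valuation0 /= leNye.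
    rewrite -(fineK (valuation_fin v u0)) in uij.
    rewrite -(@fineK _ (v (_ / _))) ?valuation_fin ?mulf_neq0 ?invr_eq0//.
    rewrite !fine_valuationM ?fine_valuationV ?mulf_neq0 ?invr_eq0// -!EFinN !lee_fin in uij *.
    by move: uij; lra.
  - by rewrite /= hE (monomial_conj_elementary _ _ _ mst).
split=> [|h k Hh Hk|h Hh]; rewrite /H /=.
- by rewrite mulg1 mulgV.
- have -> : (m * (h * k) * m^-1 = (m * h * m^-1) * (m * k * m^-1))%g.
    by rewrite !mulgA mulgVK.
  exact: PM.
- have -> : (m * h^-1 * m^-1 = (m * h * m^-1)^-1)%g.
    by rewrite !invgM invgK mulgA.
  exact: PV.
Qed.

Definition building_rel (p q : SL K n * apartment R n) : bool :=
  `[< exists m, N_maps m p.2 q.2 /\ bt_group p.2 (p.1^-1 * q.1 * m)%g >].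

Lemma building_rel_equiv : equiv_class_of building_rel.
Proof.
have PP x : subgroup (bt_group x) by exact: subgroup_generatedP.
have refl : reflexive building_rel.
  move=> [g x]; apply/asboolP; exists 1%g; split; first exact: N_maps1.
  by rewrite mulVg mulg1 /=; have [] := PP x.
have sym p q : building_rel p q -> building_rel q p.
  move=> /asboolP[m [mpq Pm]]; apply/asboolP; exists m^-1%g.
  split; first exact: N_mapsV.
  have [_ _ /(_ _ Pm)/(bt_group_conj mpq)] := PP p.2.
  by rewrite !invgM invgK !mulgA mulgV mul1g.
split=> [//|p q|q p r /asboolP[m [mpq Pm]] /asboolP[m' [mqr Pm']]].
  by apply/idP/idP; exact: sym.
apply/asboolP; exists (m' * m)%g; split; first exact: N_mapsM mqr.
have := bt_group_conj (N_mapsV mpq) Pm'; rewrite invgK => Pm'm.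
have [_ PM _] := PP p.2; have := PM _ _ Pm Pm'm.
by rewrite !mulgA !mulgK.
Qed.

Canonical building_equiv := EquivRelPack building_rel_equiv.

Definition building := {eq_quot building_equiv}.

Definition building_pt g x : building := \pi_building (g, x).

Definition building_act g (b : building) : building :=
  building_pt (g * (repr b).1)%g (repr b).2.

Definition apartment_pt x : building := building_pt 1%g x.

Definition building_stabilizer (b : building) : set (SL K n) :=
  [set g | building_act g b = b].

Lemma building_pt_eq g h x y : building_pt g x = building_pt h y <->
  exists m, N_maps m x y /\ bt_group x (g^-1 * h * m)%g.
Proof.
split=> [/eqP|gh]; first by rewrite eqmodE => /asboolP.
by apply/eqP; rewrite eqmodE; exact/asboolP.
Qed.

Lemma building_act_pt g h x :
  building_act g (building_pt h x) = building_pt (g * h)%g x.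
Proof.
rewrite /building_act; case E: (repr _) => [k y] /=.
have : building_pt k y = building_pt h x by rewrite /building_pt -E reprK.
move=> /building_pt_eq[m [mxy Pm]]; apply/building_pt_eq; exists m; split=> //.
by rewrite invgM !mulgA mulgVK.
Qed.

End Building.

Section Action.
Variables (R : realType) (K : fieldType) (v : valuation R K) (n : nat).
Implicit Types (x y : apartment R n) (m : SL K n).

Lemma normalizer_monomial m : nontrivial_val v -> normalizer_torus m ->
  exists s t, monomial m s t.
Proof.
move=> [a a0 va] Nm.
have aV : a != a^-1.
  apply/eqP => aE; apply: va; have /eqP := fine_valuationV v a0; rewrite -aE.
  rewrite -addr_eq0 -mulr2n mulrn_eq0 /= => /eqP va0.
  by rewrite -(fineK (valuation_fin v a0)) va0.
have Nmt (t : 'rV[K]_n) : \prod_i t 0 i = 1 ->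
    exists t' : 'rV[K]_n, forall i j, m i j * t 0 j = t' 0 i * m i j.
  move=> t1; have dt : \det (diag_mx t) == 1 by rewrite det_diag t1.
  have : torus (MkSL dt) by rewrite /torus /= diag_mx_is_diag.
  rewrite -Nm => -[t' /is_diag_mxP t'd t'm]; exists (\row_i t' i i) => i j.
  have mt : (m * MkSL dt)%g = (t' * m)%g by rewrite -t'm /= mulVKg.
  have /(congr1 (fun g : SL K n => g i j)) := mt.
  rewrite !SL_mulE mul_mx_diag !mxE => ->.
  rewrite (bigD1 i)//= big1 ?addr0// => k ki.
  by rewrite t'd ?mul0r// eq_sym.
have uniq i j k : m i j != 0 -> m i k != 0 -> j = k.
  move=> mij mik; apply/eqP/negP => /negP jk.
  have [|t' t'P] := Nmt (\row_l if l == j then a else if l == k then a^-1 else 1).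
    rewrite (bigD1 j)//= (bigD1 k) ?(eq_sym k)//= big1 => [|l /andP[lj lk]].
      by rewrite !mxE ?eqxx (eq_sym k) (negPf jk) mulr1 mulfV.
    by rewrite !mxE (negPf lj) (negPf lk).
  have := t'P i k; rewrite mxE (eq_sym k) (negPf jk) eqxx mulrC => /(mulIf mik) t'1.
  have := t'P i j; rewrite mxE eqxx mulrC => /(mulIf mij) t'2.
  by rewrite t'1 -t'2 eqxx in aV.
have nzrow i : exists j, m i j != 0.
  apply/existsP; apply: contraT; rewrite negb_exists => /forallP m0.
  have /matrixP/(_ i i) := mulmxV (SL_unitmx m); rewrite !mxE eqxx big1.
    by move=> /esym/eqP; rewrite oner_eq0.
  by move=> k _; have := m0 k; rewrite negbK => /eqP ->; rewrite mul0r.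
have nzcol j : exists i, m i j != 0.
  apply/existsP; apply: contraT; rewrite negb_exists => /forallP m0.
  have /matrixP/(_ j j) := mulVmx (SL_unitmx m); rewrite !mxE eqxx big1.
    by move=> /esym/eqP; rewrite oner_eq0.
  by move=> k _; have := m0 k; rewrite negbK => /eqP ->; rewrite mulr0.
pose f j := xchoose (nzcol j); have fP j : m (f j) j != 0 := xchooseP (nzcol j).
have f_inj : injective f by move=> j k jk; apply: uniq (fP j) _; rewrite jk fP.
exists (perm f_inj), (fun j => m (f j) j) => j; split=> //.
apply/matrixP => i k; rewrite ord1 -colE !mxE permE eqxx andbT.
have [->|ij] := eqVneq; rewrite ?mulr1 ?mulr0//; apply/eqP.
apply: contraNT ij => mij; have [g fg gf] := injF_bij f_inj.
rewrite -(gf i); apply/eqP; congr f; apply: (uniq i _ _ _ mij).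
by rewrite -[i in m i](gf i).
Qed.

Lemma N_maps_total m x : nontrivial_val v -> normalizer_torus m ->
  exists y, N_maps v m x y.
Proof.
move=> v0 Nm; have [s [t mst]] := normalizer_monomial v0 Nm.
have t0 i : t i != 0 by have [] := mst i.
have fprod (r : seq 'I_n) : fine (v (\prod_(i <- r) t i)) = \sum_(i <- r) fine (v (t i)).
  elim: r => [|i r IH]; first by rewrite !big_nil valuation1.
  by rewrite !big_cons fine_valuationM ?IH// prodf_seq_neq0; apply/allP => j _; rewrite t0.
have vt : \sum_i fine (v (t i)) = 0.
  have mE : (m : 'M_n) = (perm_mx s)^T *m diag_mx (\row_i t i).
    apply/matrixP => i j; rewrite (monomialE mst) mul_mx_diag !mxE eq_sym.
    by case: eqP; rewrite ?mul1r ?mul0r.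
  have := det_SL m; rewrite mE det_mulmx det_tr det_perm det_diag => dm.
  rewrite (eq_bigr t) in dm; last by move=> i _; rewrite mxE.
  rewrite -fprod; case: (odd_perm s) dm => /=; rewrite ?expr1 ?expr0 ?mulN1r ?mul1r => dm.
    by rewrite -valuationN dm valuation1.
  by rewrite dm valuation1.
pose y : 'cV[R]_n := \col_i (x ((s^-1)%g i) 0 - fine (v (t ((s^-1)%g i)))).
have y0 : \sum_i y i 0 == 0.
  rewrite (reindex_inj (@perm_inj _ s)) /=.
  under eq_bigr do rewrite mxE permK.
  by rewrite sumrB vt subr0; exact: (valP x).
exists (Apartment y0); split=> //; exists s, t; split=> // i.
by rewrite mxE permK.
Qed.

End Action.

Section Tropical.
Variables (R : realType) (K : fieldType) (v : valuation R K) (n : nat).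

Definition trop_act (g : 'M[K]_n) (x : 'cV[R]_n) (i : 'I_n) : \bar R :=
  (\big[maxe/-oo]_(j < n) (- v (g i j) + (x j 0)%:E))%E.

Definition trop_stabilizes (g : 'M[K]_n) (x : 'cV[R]_n) :=
  forall i, trop_act g x i = (x i 0)%:E.

End Tropical.

(* Main.v *)
Require Import Defs.
From mathcomp Require Import all_boot all_order all_algebra.
From mathcomp Require Import classical_sets reals constructive_ereal.
From mathcomp Require Import all_fingroup lra.

Set Implicit Arguments.
Unset Strict Implicit.
Unset Printing Implicit Defensive.

Import Order.TTheory GRing.Theory Num.Theory.

Local Open Scope classical_set_scope.
Local Open Scope ring_scope.

(** Both sides are compared with a third set, the matrices of [SL_n(K)] whose
    entries satisfy [v (g i j) >= x_j - x_i], called dominated below: formally,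
    the conjugates of the integral matrices by a diagonal matrix whose entries
    have valuations [- x_i].

    Tropical stabilization adds to domination that the bound is attained in
    every row. This is automatic in [SL_n(K)] ([dominated_tight_perm]). In the
    Leibniz expansion of [\det g = 1], the bounds on the factors of the term of
    a permutation [s] add up to [\sum_i (x_(s i) - x_i) = 0], and since
    [v 1 = 0] some term has valuation at most [0]. For that [s] each factor
    [g i (s i)] attains its bound.

    Dominated matrices of determinant 1 form a group, the inverse being bounded
    by the same count of exponents applied to cofactors ([dominatedV]), and this
    group contains the generators of [P_x]. So [P_x] is contained in it.

    Conversely, a dominated [g] is reduced to a monomial matrix by row
    operations in [P_x]. Dividing by a tight entry [g i j] keeps the
    coefficients [- g k j / g i j] within the bounds that define [P_x], so
    column [j] can be cleared. Choosing the pivots along a tight permutation of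
    the current matrix guarantees that the columns cleared before stay cleared
    ([clear_column]). When all columns are cleared, the matrix is monomial with
    tight entries, hence fixes [x] and lies in [P_x].

    Finally [P_x] is the stabilizer of [(1, x)] in the building by unfolding
    the equivalence relation. *)

(** * Valuations of sums and products *)

Section ValuationOfSumsAndProducts.
Variables (R : realType) (K : fieldType) (v : valuation R K).

Lemma valuation_sum_ge (I : finType) (P : pred I) (F : I -> K) (M : \bar R) :
  (forall i, P i -> (M <= v (F i))%E) -> (M <= v (\sum_(i | P i) F i)%R)%E.
Proof.
move=> MF; elim/big_ind : _ => //.
- by rewrite valuation0 leey.
- by move=> a b Ma Mb; apply: le_trans (valuationD v a b); rewrite le_min Ma.
Qed.

Lemma valuation_prod (I : finType) (P : pred I) (F : I -> K) :
  v (\prod_(i | P i) F i)%R = (\sum_(i | P i) v (F i))%E.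
Proof. exact: (big_morph _ (valuationM v) (valuation1 v)). Qed.

Lemma valuation_signM (b : bool) (a : K) : v ((-1) ^+ b * a) = v a.
Proof. by case: b; rewrite ?expr1 ?expr0 ?mulN1r ?valuationN ?mul1r. Qed.

Lemma valuation_prod_ge (I : finType) (P : pred I) (F : I -> K) (c : I -> R) :
  (forall i, P i -> ((c i)%:E <= v (F i))%E) ->
  ((\sum_(i | P i) c i)%:E <= v (\prod_(i | P i) F i)%R)%E.
Proof. by move=> cF; rewrite valuation_prod -sumEFin lee_sum. Qed.

(** A sum of nonnegative real gaps which is at most zero has only zero terms;
    the upper bound also forces every factor to be nonzero, so that all
    valuations are real. *)
Lemma valuation_prod_tight (I : finType) (F : I -> K) (c : I -> R) :
  (forall i, ((c i)%:E <= v (F i))%E) ->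
  (v (\prod_i F i)%R <= (\sum_i c i)%:E)%E ->
  forall i, v (F i) = (c i)%:E.
Proof.
move=> cF Fc.
have F0 i : F i != 0.
  have : \prod_i F i != 0.
    by apply: contraTneq Fc => ->; rewrite valuation0 leye_eq.
  by move/prodf_neq0 => /(_ i isT).
have FE i : v (F i) = (fine (v (F i)))%:E by rewrite fineK ?valuation_fin.
rewrite valuation_prod (eq_bigr _ (fun i _ => FE i)) sumEFin lee_fin in Fc.
have gap_ge0 i : true -> 0 <= fine (v (F i)) - c i.
  by move=> _; rewrite subr_ge0 -lee_fin -FE.
have gap0 : \sum_i (fine (v (F i)) - c i) = 0.
  by apply/le_anti; rewrite sumr_ge0// andbT sumrB subr_le0.
move=> i; rewrite FE; congr _%:E; apply/eqP.
by rewrite -subr_eq0 (psumr_eq0P gap_ge0 gap0).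
Qed.

End ValuationOfSumsAndProducts.

(** * Elementary and monomial matrices *)

Section ElementaryAndMonomial.
Variables (K : fieldType) (n : nat).

Lemma det_elementary (i j : 'I_n) (u : K) : i != j -> \det (elementary i j u) = 1.
Proof.
(* Triangularity only covers one side of the diagonal; transposition exchanges
   the two sides. *)
have lower (k l : 'I_n) : (l < k)%N -> \det (elementary k l u) = 1.
  move=> lk; rewrite det_trig.
    apply: big1 => a _; rewrite !mxE eqxx.
    have [-> /=|_] := eqVneq a k; last by rewrite mulr0 addr0.
    by rewrite -val_eqE /= (gtn_eqF lk) mulr0 addr0.
  apply/is_trig_mxP => a b ab; rewrite !mxE -val_eqE /= (ltn_eqF ab).
  have [ak|] := eqVneq a k; last by rewrite mulr0 addr0.
  have [bl|] := eqVneq b l; last by rewrite mulr0 addr0.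
  by move: ab; rewrite ak bl ltnNge (ltnW lk).
rewrite neq_ltn => /orP[ij|ji]; last exact: lower.
rewrite -det_tr -(lower j i ij); congr (\det _).
by rewrite /elementary linearD linearZ /= trmx1 trmx_delta.
Qed.

(** A diagonal matrix multiplies each basis vector by a scalar, and a monomial
    matrix permutes the coordinate lines; the inverse is monomial too, which
    makes conjugation onto the torus and not only into it. *)
Lemma monomial_normalizer (m : SL K n) s t : monomial m s t -> normalizer_torus m.
Proof.
have conj_torus (h : SL K n) s' t' g :
    monomial h s' t' -> torus g -> torus (g ^ h)%g.
  move=> hst /is_diag_mxP gd; apply/is_diag_mxP => i j ij.
  have gE k : (g : 'M_n) *m delta_mx k 0 = g k k *: (delta_mx k 0 : 'cV_n).
    apply/matrixP => a b; rewrite -colE !mxE ord1 eqxx andbT.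
    by have [->|ak] := eqVneq a k; rewrite ?mulr1 // mulr0 gd.
  have [t'j0 hj] := hst j; have [_ hVj] := monomialV hst (s' j).
  have /matrixP/(_ i 0) : (g ^ h)%g *m delta_mx j 0 =
      (g (s' j) (s' j)) *: (delta_mx j 0 : 'cV_n).
    rewrite conjgE !SL_mulE -!mulmxA hj -!scalemxAr gE -scalemxAr hVj !scalerA permK.
    by rewrite mulrAC mulfV// mul1r.
  by rewrite -colE !mxE (_ : (i == j) = false) ?mulr0// -val_eqE /=; exact/negbTE.
move=> mst; rewrite /normalizer_torus; apply/seteqP; split=> [_ [g Tg <-]|g Tg].
  exact: conj_torus mst Tg.
exists (g ^ m^-1)%g; last by rewrite /= conjgKV.
exact: conj_torus (monomialV mst) Tg.
Qed.

End ElementaryAndMonomial.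

(** * Dominated matrices and tropical stabilizers *)

Section DominatedMatrices.
Variables (R : realType) (K : fieldType) (v : valuation R K) (n : nat).
Variable x : 'cV[R]_n.
Implicit Types (A B : 'M[K]_n) (g : SL K n).

(** For [x = 0] these are the matrices with entries in the valuation ring. *)
Definition dominated A := forall i j, ((x j 0 - x i 0)%:E <= v (A i j))%E.

Lemma dominatedM A B : dominated A -> dominated B -> dominated (A *m B).
Proof.
move=> dA dB i j; rewrite mxE; apply: valuation_sum_ge => k _.
have -> : x j 0 - x i 0 = (x k 0 - x i 0) + (x j 0 - x k 0) by lra.
by rewrite valuationM EFinD leeD.
Qed.

Lemma dominated1 : dominated 1%:M.
Proof.
by move=> i j; rewrite mxE; have [->|_] := eqVneq;
  rewrite ?subrr ?valuation1// valuation0 leey.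
Qed.

Lemma sum_perm_coords_sub (s : 'S_n) : \sum_i (x (s i) 0 - x i 0) = 0.
Proof. by rewrite sumrB [X in _ - X](reindex_inj (@perm_inj _ s)) subrr. Qed.

(** The inverse is the adjugate, whose [(i, j)] entry is a signed sum over the
    permutations with [s j = i] of products that leave out the row [j]. The
    bounds of the factors add up to minus the one that is left out. *)
Lemma dominatedV g : dominated g -> dominated (invmx g).
Proof.
move=> dg i j; rewrite /invmx SL_unitmx det_SL invr1 scale1r mxE expand_cofactor.
apply: valuation_sum_ge => s /eqP sji; rewrite valuation_signM.
have -> : x j 0 - x i 0 = \sum_(k | j != k) (x (s k) 0 - x k 0).
  have := sum_perm_coords_sub s; rewrite (bigD1 j)//= sji (eq_bigl (fun k => j != k)); last by move=> k; rewrite eq_sym.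
  by lra.
by apply: valuation_prod_ge => k _; exact: dg.
Qed.

(** If every Leibniz term had positive valuation, so would the determinant;
    a term of valuation at most 0 meets the total bound 0 of its factors. *)
Lemma dominated_tight_perm g : dominated g ->
  exists s : 'S_n, forall i, v (g i (s i)) = (x (s i) 0 - x i 0)%:E.
Proof.
move=> dg.
suff [s sg] : exists s : 'S_n, (v (\prod_i g i (s i))%R <= 0)%E.
  exists s; apply: (valuation_prod_tight (c := fun i => x (s i) 0 - x i 0)).
    by move=> i; exact: dg.
  by rewrite sum_perm_coords_sub.
apply/existsP; apply: contraT; rewrite negb_exists => /forallP vpos.
suff : (0 < v (\det g))%E by rewrite det_SL valuation1 ltxx.
apply: (big_ind (fun a => 0 < v a)%E).
- by rewrite valuation0 ltry.
- by move=> a b a0 b0; apply: lt_le_trans (valuationD v a b); rewrite lt_min a0.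
- by move=> s _; rewrite valuation_signM ltNge vpos.
Qed.

(** Domination says that no term of the row maxima exceeds [x_i]; a tight
    permutation provides in each row a term that reaches it. *)
Lemma trop_stabilizesP g : trop_stabilizes v g x <-> dominated g.
Proof.
have bound i j : (- v (g i j) + (x j 0)%:E <= (x i 0)%:E)%E =
    ((x j 0 - x i 0)%:E <= v (g i j))%E.
  have [->|gij0] := eqVneq (g i j) 0; first by rewrite valuation0 /= leey leNye.
  by rewrite -(fineK (valuation_fin v gij0)) -EFinN -EFinD !lee_fin; apply/idP/idP; lra.
split=> [sg i j|dg i].
  by rewrite -bound -(sg i) /trop_act; exact: le_bigmax.
have [s sg] := dominated_tight_perm dg.
apply/le_anti/andP; split.
  by apply: bigmax_le => [|j _]; [exact: leNye | rewrite bound; exact: dg].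
apply: le_trans (le_bigmax _ _ (s i)).
by rewrite sg -EFinN -EFinD lee_fin; lra.
Qed.

End DominatedMatrices.

(** * Generation of dominated matrices by the Bruhat-Tits generators *)

Section BruhatTitsGroup.
Variables (R : realType) (K : fieldType) (v : valuation R K) (n : nat).
Variable x : apartment R n.
Implicit Types (A : 'M[K]_n) (g p : SL K n).

Lemma bt_group_dominated g : bt_group v x g -> dominated v x g.
Proof.
apply: (smallest_sub (X := [set h : SL K n | dominated v x h])).
  split=> [|h k|h] /=; [exact: dominated1 | exact: dominatedM | exact: dominatedV].
move=> h [[_ [s [t [hst xE]]]]|[i [j [u [ij uij hE]]]]] a b /=.
  rewrite (monomialE hst); have [->|_] := eqVneq; last by rewrite valuation0 leey.
  have [tb0 _] := hst b.
  by rewrite xE -(fineK (valuation_fin v tb0)) lee_fin; lra.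
rewrite hE !mxE; apply: le_trans (valuationD _ _ _); rewrite le_min.
apply/andP; split; first by have := dominated1 v x a b; rewrite mxE.
have [->|_] := eqVneq a i; last by rewrite mulr0 valuation0 leey.
have [->|_] := eqVneq b j; last by rewrite mulr0 valuation0 leey.
by rewrite mulr1 -leeN2 -EFinN opprB.
Qed.

Lemma bt_group_elementary p (i j : 'I_n) (u : K) : i != j ->
  ((x j 0 - x i 0)%:E <= v u)%E -> (p : 'M_n) = elementary i j u ->
  bt_group v x p.
Proof.
move=> ij uij pE; apply: sub_gen_smallest; right; exists i, j, u; split=> //.
by rewrite -(opprB (x j 0)) EFinN leeN2.
Qed.

(** Elementary matrices [elementary k i _] with the same column index [i] and
    [k != i] multiply by adding their off-diagonal parts. *)
Lemma bt_group_column_transvection (i : 'I_n) (w : 'I_n -> K) :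
  (forall k, ((x i 0 - x k 0)%:E <= v (w k))%E) ->
  exists2 p, bt_group v x p &
    (p : 'M_n) = 1%:M + \sum_(k | k != i) w k *: delta_mx k i.
Proof.
move=> wP; have [P1 PM _] : subgroup (bt_group v x) by exact: subgroup_generatedP.
elim: (index_enum _) => [|k r [p Pp pE]].
  by exists 1%g => //; rewrite big_nil addr0.
rewrite big_cons; have [_|ki] := eqVneq k i; first by exists p.
have dk : \det (elementary k i (w k)) == 1 by rewrite det_elementary.
exists (MkSL dk * p)%g.
  by apply: PM => //; exact: bt_group_elementary ki (wP k) _.
rewrite SL_mulE /= /elementary mulmxDl mul1mx {1}pE -addrA; congr (_ + _).
rewrite addrC; congr (_ + _); rewrite -scalemxAl pE mulmxDr mulmx1 mulmx_sumr big1 ?addr0//.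
by move=> l li; rewrite -scalemxAr mul_delta_mx_0 ?scaler0// eq_sym.
Qed.

(** A monomial matrix fixes [x] precisely when its nonzero entries are tight. *)
Lemma tight_monomial_bt_group g (s : 'S_n) :
  (forall i j, j != s i -> g i j = 0) ->
  (forall i, v (g i (s i)) = (x (s i) 0 - x i 0)%:E) -> bt_group v x g.
Proof.
move=> g0 sg; apply: sub_gen_smallest; left.
have mst : monomial g (s^-1)%g (fun j => g ((s^-1)%g j) j).
  move=> j; split.
    have := sg ((s^-1)%g j); rewrite permKV => vg.
    by apply: contra_eq_neq vg => ->; rewrite valuation0.
  apply/matrixP => i k; rewrite ord1 -colE !mxE eqxx andbT.
  have [->|ij] := eqVneq i ((s^-1)%g j); first by rewrite mulr1.
  by rewrite mulr0 g0//; apply: contraNneq ij => ->; rewrite permK.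
split; first exact: monomial_normalizer mst.
exists (s^-1)%g, (fun j => g ((s^-1)%g j) j); split=> // j.
by have := sg ((s^-1)%g j); rewrite permKV => -> /=; lra.
Qed.

(** The row [i] is left unspecified: in an invertible matrix it is the row of
    the nonzero entry of column [j], so every tight permutation sends it to
    [j]. *)
Definition cleared A (j : 'I_n) := [exists i, [forall k, (k != i) ==> (A k j == 0)]].

Lemma clearedP A j : reflect (exists i, forall k, k != i -> A k j = 0) (cleared A j).
Proof.
apply: (iffP existsP) => -[i Ai]; exists i.
  by move=> k ki; apply/eqP; move/forallP/(_ k)/implyP: Ai; exact.
by apply/forallP => k; apply/implyP => /Ai/eqP.
Qed.

(** The pivot of column [j] is the row [i] with [s i = j] for a tight
    permutation [s] of [g]. A column [l] cleared before has its only nonzero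
    entry in the row that [s] sends to [l], which is not [i]. So the pivot row
    vanishes at [l], and subtracting multiples of it does not alter column
    [l]. *)
Lemma clear_column g j : dominated v x g -> ~~ cleared g j ->
  exists2 p, bt_group v x p &
    cleared (p * g)%g j /\ forall l, cleared g l -> cleared (p * g)%g l.
Proof.
move=> dg ncj; have [s sg] := dominated_tight_perm dg.
have g0 i : g i (s i) != 0.
  by apply: contra_eq_neq (sg i) => ->; rewrite valuation0.
pose i := (s^-1)%g j; have sij : s i = j by rewrite /i permKV.
have [gij0 vgij] := (g0 i, sg i); rewrite sij in gij0 vgij.
have [k|p Pp pE] := bt_group_column_transvection (i := i) (w := fun k => - (g k j / g i j)).
  rewrite valuationN valuationM.
  (* tightness turns [v (g i j)^-1] into [x_i - x_j], to be added to the bound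
     [x_j - x_k] of [g k j] *)
  have := dg k j; have [->|gkj0] := eqVneq (g k j) 0.
    by rewrite valuation0 addye ?leey//; have := valuation_gtNy v (g i j)^-1; case: (v _).
  rewrite -(fineK (valuation_fin v gkj0)) -(fineK (valuation_fin v (a := (g i j)^-1) _)) ?invr_eq0//.
  by rewrite fine_valuationV// vgij -EFinD !lee_fin /=; lra.
(* Row [i] is kept, and every other row loses the multiple of row [i] that
   cancels its entry in column [j]. *)
have pgE k l : (p * g)%g k l = g k l - (if k == i then 0 else g k j / g i j * g i l).
  rewrite SL_mulE pE mulmxDl mul1mx mxE mulmx_suml summxE; congr (_ + _).
  have dE a : ((- (g a j / g i j)) *: delta_mx a i *m (g : 'M_n)) k l =
      if k == a then - (g a j / g i j * g i l) else 0.
    rewrite -scalemxAl 2!mxE (bigD1 i)//= big1 => [|b bi]; last by rewrite mxE (negPf bi) andbF mul0r.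
    rewrite mxE eqxx andbT addr0; have [_|_] := eqVneq k a; last by rewrite mul0r mulr0.
    by rewrite mul1r mulNr.
  rewrite (eq_bigr _ (fun a _ => dE a)).
  have [->|ki] := eqVneq k i.
    by rewrite big1 ?oppr0// => a ai; rewrite eq_sym (negPf ai).
  by rewrite (bigD1 k)//= eqxx big1 ?addr0// => a /andP[_ /negPf ak]; rewrite eq_sym ak.
exists p => //; split.
  apply/clearedP; exists i => k ki; rewrite pgE (negPf ki).
  by rewrite -mulrA mulVf// mulr1 subrr.
move=> l /clearedP[i' gl0].
have gil0 : g i l = 0.
  apply: (gl0); apply: contra ncj => /eqP ii'.
  (* If the nonzero entry of column [l] were in row [i], it would be the one
     that [s] selects there, in column [j]. *)
  suff <- : l = j by apply/clearedP; exists i'.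
  rewrite -sij -[l](permKV s); congr (s _); rewrite ii'.
  apply/eqP/negP => /negP /gl0/eqP; apply/negP.
  by have := g0 ((s^-1)%g l); rewrite permKV.
apply/clearedP; exists i' => k ki'; rewrite pgE gl0// gil0 mulr0.
by rewrite if_same subr0.
Qed.

(** Clearing a column lowers the number of columns that are not cleared. When
    there are none, a tight permutation locates the only nonzero entry of each
    column, so the matrix is monomial. *)
Lemma dominated_bt_group g : dominated v x g -> bt_group v x g.
Proof.
have [P1 PM PV] : subgroup (bt_group v x) by exact: subgroup_generatedP.
have [N] := ubnP #|[pred j | ~~ cleared g j]|; elim: N g => // N IH g gN dg.
have [/forallP cg|] := boolP [forall j, cleared g j].
  have [s sg] := dominated_tight_perm dg.
  apply: (tight_monomial_bt_group (s := s)) => // i j jsi.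
  have /clearedP[i' gj0] := cg j; apply: (gj0).
  apply: contra_neq jsi => ->; rewrite -[j](permKV s); congr (s _).
  apply/eqP/negP => /negP /gj0/eqP; apply/negP.
  apply: contra_eqN (sg ((s^-1)%g j)) => /eqP; rewrite permKV => ->.
  by rewrite valuation0.
rewrite negb_forall => /existsP[j ncj].
have [p Pp [cj cg]] := clear_column dg ncj.
rewrite -[g](mulKg p); apply: (PM) (PV _ Pp) _; apply: IH; last first.
  by apply: dominatedM => //; exact: bt_group_dominated.
rewrite -ltnS; apply: leq_trans gN; rewrite ltnS; apply: proper_card; apply/properP; split.
  by apply/fintype.subsetP => l; rewrite !inE; apply: contra; exact: cg.
by exists j; rewrite !inE // cj.
Qed.

(** [(g, x)] and [(1, x)] are identified when [g^-1 m] is in [P_x] for some [m]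
    fixing [x] in [N(K)], and such an [m] is itself a generator of [P_x]. *)
Lemma building_stabilizer_bt_group :
  building_stabilizer (apartment_pt v x) = bt_group v x.
Proof.
have [P1 PM PV] : subgroup (bt_group v x) by exact: subgroup_generatedP.
apply/seteqP; split=> g; rewrite /building_stabilizer /apartment_pt /=
  building_act_pt mulg1.
  move=> /building_pt_eq[m [Nm]]; rewrite mulg1 => Pgm.
  have Pm : bt_group v x m by apply: sub_gen_smallest; left.
  by have := PM _ _ Pm (PV _ Pgm); rewrite invgM invgK mulKVg.
move=> Pg; apply/building_pt_eq; exists 1%g; split; first exact: N_maps1.
by rewrite !mulg1; exact: PV.
Qed.

End BruhatTitsGroup.

Theorem proposition2p4 (R : realType) (K : fieldType) (v : valuation R K)
    (v_nontrivial : nontrivial_val v) (v_discrete : discrete_val v)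
    (v_complete : complete_val v) (k_perfect : perfect_residue_field v)
    (n : nat) (n_gt0 : (0 < n)%N) (x : apartment R n) :
  bt_group v x = building_stabilizer (apartment_pt v x) /\
  building_stabilizer (apartment_pt v x) =
    [set g : SL K n | trop_stabilizes v g x].
Proof.
rewrite building_stabilizer_bt_group; split=> //; apply/seteqP; split=> g /=.
  by move=> /bt_group_dominated dg; apply/trop_stabilizesP.
by move=> /trop_stabilizesP dg; exact: dominated_bt_group.
Qed.
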